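(* Let $L>0$ and consider the plant with state $\chi(z,t)\in\mathbb{R}^n$, $z\in[0,L]$, lumped input $u(t)\in\mathbb{R}^m$ and distributed output density $y(z,t)\in\mathbb{R}^m$, $$\partial_t\chi = P_1\partial_z(\mathcal{Q}\chi)+(P_0-G_0)\mathcal{Q}\chi+\mathcal{B}u,\qquad y=\mathcal{B}^T\mathcal{Q}\chi,\qquad W_{\mathcal B}\begin{bmatrix} f_\partial(t)\\ e_\partial(t)\end{bmatrix}=0,$$ and the finite-dimensional controller with state $v_c(t)\in\mathbb{R}^{n_c}$, $$\dot v_c=(A_c-S_c)Q_cv_c+B_cu_c,\qquad \check y_c=B_c^TQ_cv_c,$$ with matrices and boundary port variables $f_\partial,e_\partial$ as specified in the context. Let plant and controller be interconnected by $$u=-\check y_c,\qquad u_c=\bar y:=\int_0^L y\,\mathrm{d}z .$$ Let $\Gamma\in\mathbb{R}^{n_c}$ and $\Psi:[0,L]\to\mathbb{R}^n$, and consider the functional $$C(\chi,v_c)=\Gamma^Tv_c+\int_0^L\Psi^T(z)\,\chi(z,t)\,\mathrm{d}z .$$ Suppose that (i) $(A_c+S_c)\Gamma=0$; (ii) $P_1\partial_z\Psi+(P_0+G_0)\Psi-\mathcal{B}B_c^T\Gamma=0$ on $[0,L]$; (iii) $B_c\mathcal{B}^T\Psi=0$ on $[0,L]$; (iv) $\begin{bmatrix} e_\partial^T(t) & f_\partial^T(t)\end{bmatrix}R\begin{bmatrix}\Psi(L)\\ \Psi(0)\end{bmatrix}=0$ for all $t$ along the solutions of the closed loop. Then $C$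 is a structural invariant of the closed loop, i.e. $\frac{\mathrm{d}}{\mathrm{d}t}C(\chi(\cdot,t),v_c(t))=0$ along every solution of the closed loop, whatever the energy functions (i.e. whatever the matrices $\mathcal{Q}$ and $Q_c$ of the class specified in the context).
   Context: Plant data: $P_1=P_1^T\in\mathbb{R}^{n\times n}$ is invertible; $P_0=-P_0^T\in\mathbb{R}^{n\times n}$; $G_0=G_0^T\in\mathbb{R}^{n\times n}$ is positive semidefinite; $\mathcal{Q}:[0,L]\to\mathbb{R}^{n\times n}$ is bounded and continuously differentiable with $\mathcal{Q}(z)=\mathcal{Q}^T(z)$ and $\underline{q}I\le\mathcal{Q}(z)\le \overline{q}I$ for all $z\in[0,L]$, with constants $\underline{q},\overline{q}>0$; $\mathcal{B}:[0,L]\to\mathbb{R}^{n\times m}$ is a (square-integrable) matrix-valued function of $z$; $W_{\mathcal B}$ is a real matrix with $2n$ columns. The plant Hamiltonian is $\frac12\int_0^L\chi^T\mathcal{Q}\chi\,\mathrm{d}z$. Boundary port variables: $f_\partial(t),e_\partial(t)\in\mathbb{R}^n$ are defined by $$\begin{bmatrix} f_\partial(t)\\ e_\partial(t)\end{bmatrix}=R\begin{bmatrix}\mathcal{Q}(L)\chi(L,t)\\ \mathcal{Q}(0)\chi(0,t)\end{bmatrix},\qquad R=\frac{1}{\sqrt2}\begin{bmatrix}P_1&-P_1\\ I&I\end{bmatrix}.$$ Controller data: $A_c=-A_c^T\in\mathbb{R}^{n_c\times n_c}$; $S_c=S_c^T\in\mathbb{R}^{n_c\times n_c}$ is positive semidefinite;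 $Q_c=Q_c^T\in\mathbb{R}^{n_c\times n_c}$, with controller Hamiltonian $\frac12v_c^TQ_cv_c$; $B_c\in\mathbb{R}^{n_c\times m}$. Regularity conventions: $\Psi\in H^1([0,L];\mathbb{R}^n)$ and conditions (ii), (iii) hold for almost every $z$. A solution of the closed loop is a classical one: $t\mapsto\chi(\cdot,t)$ is continuously differentiable with values in $L^2([0,L];\mathbb{R}^n)$, $\mathcal{Q}\chi(\cdot,t)\in H^1([0,L];\mathbb{R}^n)$ for every $t$, $v_c$ is continuously differentiable, and the closed-loop equations and boundary conditions hold for every $t$ (the plant equation in $L^2$). *)

(* Defs.v *)
From HB Require Import structures.
From mathcomp Require Import all_boot all_order all_algebra.
From mathcomp Require Import all_classical all_reals all_analysis.

Set Implicit Arguments.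
Unset Strict Implicit.
Unset Printing Implicit Defensive.

Import Order.TTheory GRing.Theory Num.Theory.
Import numFieldNormedType.Exports.

Local Open Scope classical_set_scope.
Local Open Scope ring_scope.

(* Derivative at [t] of [f] restricted to [D]; it is one-sided at an endpoint
   of an interval [D]. *)
Definition derivative_within (R : realType) (V : normedModType R)
    (D : set R) (f : R -> V) (t : R) (l : V) : Prop :=
  (s - t)^-1 *: (f s - f t) @[s --> within D t^'] --> l.

Definition is_C1_on (R : realType) (V : normedModType R)
    (D : set R) (f f' : R -> V) : Prop :=
  {within D, continuous f'} /\ forall t, D t -> derivative_within D f t (f' t).

Definition symmetric_mx (R : realType) n (A : 'M[R]_n) : Prop := A^T = A.

Definition skew_symmetric_mx (R : realType) n (A : 'M[R]_n) : Prop :=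
  A^T = - A.

Definition psd_mx (R : realType) n (A : 'M[R]_n) : Prop :=
  forall x : 'cV[R]_n, 0 <= (x^T *m A *m x) 0 0.

(* Matrix-valued L^2 is taken entrywise; functions are extended by 0 outside
   of [0, L]. *)
Definition is_L2 (R : realType) p q (L : R) (f : R -> 'M[R]_(p, q)) : Prop :=
  forall i j, ((fun z => f z i j) \_ `[0, L]) \in
    Lfun (@lebesgue_measure R) 2%:E.

Definition L2_norm (R : realType) (L : R) (f : R -> R) : \bar R :=
  ('N[@lebesgue_measure R]_2%:E [EFin \o (f \_ `[0%R, L]%classic)%R])%E.

Definition L2_cvg (R : realType) p q (L : R) (f : R -> R -> 'M[R]_(p, q))
    (F : set_system R) (l : R -> 'M[R]_(p, q)) : Prop :=
  forall i j,
    L2_norm L (fun z => f s z i j - l z i j) @[s --> F] --> 0%E.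

(* [f] maps [J] to L^2, is continuously differentiable for the L^2 norm, and
   has derivative [f']; the first argument of [f] and [f'] is the time. *)
Definition is_C1_L2 (R : realType) p q (L : R) (J : set R)
    (f f' : R -> R -> 'M[R]_(p, q)) : Prop :=
  forall t, J t ->
  [/\ is_L2 L (f t),
      is_L2 L (f' t),
      L2_cvg L (fun s z => (s - t)^-1 *: (f s z - f t z))
        (within J t^') (f' t) &
      L2_cvg L f' (within J (nbhs t)) (f' t)].

(* C^1 functions with compact support in ]0, L[; they define the same weak
   derivatives as the smooth ones. *)
Definition test_function (R : realType) (L : R) (phi : R -> R) : Prop :=
  [/\ forall x, derivable phi x 1,
      continuous (derive1 phi) &
      exists a b, [/\ 0 < a, b < L &
        forall x, x \notin `[a, b] -> phi x = 0]].

Definition weak_derivative (R : realType) n (L : R)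
    (f df : R -> 'cV[R]_n) : Prop :=
  forall phi, test_function L phi -> forall i,
    \int[@lebesgue_measure R]_(z in `[0, L]) (f z i 0 * derive1 phi z) =
    - \int[@lebesgue_measure R]_(z in `[0, L]) (df z i 0 * phi z).

(* [f] belongs to H^1([0, L]; R^n) and has weak derivative [df]. An element of
   H^1 is given by its continuous representative, so that [f 0] and [f L] are
   its boundary values. *)
Definition is_H1 (R : realType) n (L : R) (f df : R -> 'cV[R]_n) : Prop :=
  [/\ {within `[0, L], continuous f},
      is_L2 L f, is_L2 L df & weak_derivative L f df].

Record plant (R : realType) (n m k : nat) := Plant {
  P1 : 'M[R]_n;
  P0 : 'M[R]_n;
  G0 : 'M[R]_n;
  inB : R -> 'M[R]_(n, m);
  WB : 'M[R]_(k, n + n)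
}.

Definition plant_assumptions (R : realType) n m k (L : R)
    (p : plant R n m k) : Prop :=
  [/\ symmetric_mx (P1 p) /\ P1 p \in unitmx,
      skew_symmetric_mx (P0 p),
      symmetric_mx (G0 p) /\ psd_mx (G0 p) &
      is_L2 L (inB p)].

Record controller (R : realType) (nc m : nat) := Controller {
  Ac : 'M[R]_nc;
  Sc : 'M[R]_nc;
  Bc : 'M[R]_(nc, m)
}.

Definition controller_assumptions (R : realType) nc m
    (c : controller R nc m) : Prop :=
  skew_symmetric_mx (Ac c) /\ (symmetric_mx (Sc c) /\ psd_mx (Sc c)).

(* Admissible densities of the plant energy
   1/2 \int_0^L chi^T Q chi dz. *)
Definition plant_energy_matrix (R : realType) n (L : R)
    (Q : R -> 'M[R]_n) : Prop :=
  [/\ [bounded Q z | z in `[0, L]],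
      exists Q', is_C1_on `[0, L] Q Q',
      forall z, z \in `[0, L] -> symmetric_mx (Q z) &
      exists ql qu, [/\ 0 < ql, 0 < qu &
        forall z, z \in `[0, L] ->
          psd_mx (Q z - ql%:M) /\ psd_mx (qu%:M - Q z)]].

Definition portR (R : realType) n (A : 'M[R]_n) : 'M[R]_(n + n) :=
  (Num.sqrt 2)^-1 *: block_mx A (- A) 1%:M 1%:M.

(* The stacked boundary port variables [f_bnd; e_bnd]. *)
Definition boundary_ports (R : realType) n m k (L : R) (p : plant R n m k)
    (Q : R -> 'M[R]_n) (x : R -> 'cV[R]_n) : 'cV[R]_(n + n) :=
  portR (P1 p) *m col_mx (Q L *m x L) (Q 0 *m x 0).

Definition f_bnd (R : realType) n m k (L : R) (p : plant R n m k)
    (Q : R -> 'M[R]_n) (x : R -> 'cV[R]_n) : 'cV[R]_n :=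
  usubmx (boundary_ports L p Q x).

Definition e_bnd (R : realType) n m k (L : R) (p : plant R n m k)
    (Q : R -> 'M[R]_n) (x : R -> 'cV[R]_n) : 'cV[R]_n :=
  dsubmx (boundary_ports L p Q x).

Definition plant_output (R : realType) n m k (p : plant R n m k)
    (Q : R -> 'M[R]_n) (x : R -> 'cV[R]_n) (z : R) : 'cV[R]_m :=
  (inB p z)^T *m Q z *m x z.

Definition mean_output (R : realType) n m k (L : R) (p : plant R n m k)
    (Q : R -> 'M[R]_n) (x : R -> 'cV[R]_n) : 'cV[R]_m :=
  \col_i \int[@lebesgue_measure R]_(z in `[0, L]) plant_output p Q x z i 0.

Definition controller_output (R : realType) nc m (c : controller R nc m)
    (Qc : 'M[R]_nc) (v : 'cV[R]_nc) : 'cV[R]_m :=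
  (Bc c)^T *m Qc *m v.

(* Plant equation with lumped input [u] and boundary conditions, on the time
   set [J]; the first argument of [chi] and [chi'] is the time. *)
Definition plant_solution (R : realType) n m k (L : R) (p : plant R n m k)
    (Q : R -> 'M[R]_n) (J : set R) (u : R -> 'cV[R]_m)
    (chi : R -> R -> 'cV[R]_n) : Prop :=
  exists2 chi', is_C1_L2 L J chi chi' &
  forall t, J t ->
    (exists2 dw, is_H1 L (fun z => Q z *m chi t z) dw &
      {ae @lebesgue_measure R, forall z, z \in `[0, L] ->
        chi' t z = P1 p *m dw z + (P0 p - G0 p) *m (Q z *m chi t z)
                   + inB p z *m u t}) /\
    WB p *m col_mx (f_bnd L p Q (chi t)) (e_bnd L p Q (chi t)) = 0.

Definition controller_solution (R : realType) nc m (c : controller R nc m)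
    (Qc : 'M[R]_nc) (J : set R) (uc : R -> 'cV[R]_m)
    (v : R -> 'cV[R]_nc) : Prop :=
  exists2 v', is_C1_on J v v' &
  forall t, J t -> v' t = (Ac c - Sc c) *m Qc *m v t + Bc c *m uc t.

Definition closed_loop_solution (R : realType) n m k nc (L : R)
    (p : plant R n m k) (c : controller R nc m)
    (Q : R -> 'M[R]_n) (Qc : 'M[R]_nc) (J : set R)
    (chi : R -> R -> 'cV[R]_n) (v : R -> 'cV[R]_nc) : Prop :=
  plant_solution L p Q J (fun t => - controller_output c Qc (v t)) chi /\
  controller_solution c Qc J (fun t => mean_output L p Q (chi t)) v.

Definition time_interval (R : realType) (J : set R) : Prop :=
  is_interval J /\ exists s t, [/\ J s, J t & s < t].

Definition casimir (R : realType) n nc (L : R) (Gamma : 'cV[R]_nc)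
    (Psi : R -> 'cV[R]_n) (x : R -> 'cV[R]_n) (v : 'cV[R]_nc) : R :=
  (Gamma^T *m v) 0 0
  + \int[@lebesgue_measure R]_(z in `[0, L]) ((Psi z)^T *m x z) 0 0.

Definition invariant_along_solutions (R : realType) n m k nc (L : R)
    (p : plant R n m k) (c : controller R nc m)
    (Q : R -> 'M[R]_n) (Qc : 'M[R]_nc) (J : set R)
    (C : (R -> 'cV[R]_n) -> 'cV[R]_nc -> R) : Prop :=
  forall chi v, closed_loop_solution L p c Q Qc J chi v ->
  forall t, J t -> derivative_within J (fun s => C (chi s) (v s) : R^o) t 0.

(* Main.v *)
(** Differentiating C along a solution gives
    Gamma^T v_c' + \int_0^L Psi^T chi', by Hoelder's inequality since chi is C^1
    into L^2. Conditions (i) and (iii) remove the terms in Q_c v_c, and (ii)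
    turns the rest into the integral of
    Psi^T P_1 w' + (Psi')^T P_1 w with w = Q chi, which integration by parts in
    H^1 evaluates to [Psi^T P_1 w]_0^L; this is the boundary form in (iv).

    Integration by parts in H^1 follows by Fubini on the triangle s <= t from
    f(x) = f(0) + \int_0^x f', itself obtained by testing the weak derivative
    against C^1 regularizations of the indicator functions of subintervals. *)

Require Import Defs.
From HB Require Import structures.
From mathcomp Require Import all_boot all_order all_algebra.
From mathcomp Require Import all_classical all_reals all_analysis.
From mathcomp Require Import measurable_realfun.
From mathcomp Require Import ring lra.

Set Implicit Arguments.
Unset Strict Implicit.
Unset Printing Implicit Defensive.

Import Order.TTheory GRing.Theory Num.Theory.
Import numFieldNormedType.Exports.

Local Open Scope classical_set_scope.
Local Open Scope ring_scope.

(** * C^1 regularizations of indicator functions *)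

Section smoothstep.
Context {R : realType}.
Implicit Types (x a b k : R).

Definition pos_part x : R := Num.max x 0.

Lemma continuous_pos_part : continuous pos_part.
Proof. by move=> x; apply: continuous_max => //; exact: cvg_cst. Qed.

(** Squaring removes the kink at 0: in all four sign cases the first-order remainder is at most h^2,
    so the difference quotient stays within |h| of its limit. *)
Lemma is_derive_pos_part_sqr x :
  is_derive x 1 (fun y => pos_part y ^+ 2) (2 * pos_part x).
Proof.
have bnd h : `|pos_part (h + x) ^+ 2 - pos_part x ^+ 2 - h * (2 * pos_part x)|
    <= `|h| ^+ 2.
  rewrite real_normK ?num_real// /pos_part ler_norml.
  case: (leP (h + x) 0) => h1; case: (leP x 0) => h2;
    by apply/andP; split; nra.
have cv : h^-1 *: (pos_part (h *: 1 + x) ^+ 2 - pos_part x ^+ 2)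
    @[h --> 0^'] --> 2 * pos_part x.
  apply/cvgrPdist_le => e e0.
  near=> h.
  have h0 : h != 0 by near: h; exact: nbhs_dnbhs_neq.
  have he : `|h| <= e.
    near: h; apply: dnbhs0_le => //.
  rewrite /= [h *: 1]mulr1 distrC.
  have -> : h^-1 *: (pos_part (h + x) ^+ 2 - pos_part x ^+ 2) - 2 * pos_part x =
     h^-1 * (pos_part (h + x) ^+ 2 - pos_part x ^+ 2 - h * (2 * pos_part x)).
    by rewrite mulrBr mulKf.
  rewrite normrM normfV ler_pdivrMl ?normr_gt0//.
  by rewrite (le_trans (bnd h))// expr2 ler_wpM2l.
by apply: DeriveDef; [apply/cvg_ex; exists (2 * pos_part x)|exact/cvg_lim].
Unshelve. all: end_near. Qed.

(** A quadratic spline with knots 0, 1/2 and 1: it equals 2 x^2 on [0, 1/2] and 1 - 2 (1 - x)^2 on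
    [1/2, 1], hence is C^1, as [test_function] demands. *)
Definition smoothstep x : R :=
  2 * (pos_part x ^+ 2 - 2 * pos_part (x - 2^-1) ^+ 2 + pos_part (x - 1) ^+ 2).

(** The derivative of [smoothstep]: a hat on [0, 1] with peak 2 at 1/2, hence of mass one. *)
Definition bump x : R :=
  4 * (pos_part x - 2 * pos_part (x - 2^-1) + pos_part (x - 1)).

Lemma smoothstep_le0 x : x <= 0 -> smoothstep x = 0.
Proof.
move=> x0; rewrite /smoothstep /pos_part !max_r//; [|lra..].
by rewrite expr0n/=; lra.
Qed.

Lemma smoothstep_ge1 x : 1 <= x -> smoothstep x = 1.
Proof. by move=> x1; rewrite /smoothstep /pos_part !max_l; [field|lra..]. Qed.

Lemma smoothstep_itv x : 0 <= smoothstep x <= 1.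
Proof.
rewrite /smoothstep /pos_part.
case: (leP x 0) => h1; case: (leP (x - 2^-1) 0) => h2;
  case: (leP (x - 1) 0) => h3; try lra; apply/andP; split; nra.
Qed.

Lemma bump_ge0 x : 0 <= bump x.
Proof.
rewrite /bump /pos_part.
by case: (leP x 0) => h1; case: (leP (x - 2^-1) 0) => h2;
  case: (leP (x - 1) 0) => h3; lra.
Qed.

Lemma bump_eq0 x : x <= 0 \/ 1 <= x -> bump x = 0.
Proof.
rewrite /bump /pos_part => x01.
by case: (leP x 0) => h1; case: (leP (x - 2^-1) 0) => h2;
  case: (leP (x - 1) 0) => h3; lra.
Qed.

Lemma continuous_bump : continuous bump.
Proof.
move=> x; apply: cvgM; first exact: cvg_cst.
have shift c : pos_part (y - c) @[y --> x] --> pos_part (x - c).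
  apply: (@continuous_comp _ _ _ (fun y => y - c) pos_part); last first.
    exact: continuous_pos_part.
  by apply: cvgB; [exact: cvg_id|exact: cvg_cst].
apply: cvgD; last exact: shift.
apply: cvgB; first exact: continuous_pos_part.
by apply: cvgM; [exact: cvg_cst|exact: shift].
Qed.

Lemma is_derive1_affine_comp (f : R -> R) (a k x d : R) :
  is_derive (k * (x - a)) 1 f d ->
  is_derive x 1 (fun y => f (k * (y - a))) (k * d).
Proof.
move=> fd; rewrite mulrC.
apply: (@is_derive1_comp _ f (fun y => k * (y - a))).
by apply: is_derive_eq; rewrite /GRing.scale/= subr0 mulr1.
Qed.

Lemma is_derive_smoothstep x : is_derive x 1 smoothstep (bump x).
Proof.
have shift c : is_derive x 1 (fun y => pos_part (y - c) ^+ 2)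
    (2 * pos_part (x - c)).
  have := @is_derive1_affine_comp (fun y => pos_part y ^+ 2) c 1 x
    (2 * pos_part (x - c)).
  rewrite !mul1r => /(_ (is_derive_pos_part_sqr _)).
  by under [X in is_derive _ _ X]eq_fun do rewrite mul1r.
have h0 := is_derive_pos_part_sqr x.
have h1 := shift 2^-1; have h2 := shift 1.
rewrite /smoothstep /bump; apply: is_derive_eq; rewrite /GRing.scale/=.
ring.
Qed.

(* Regularizes the indicator function of ]a, b] as k tends to infinity. *)
Definition plateau k a b x : R :=
  smoothstep (k * (x - a)) - smoothstep (k * (x - b)).

(** A difference of two approximate Dirac masses, concentrated just to the right of [a] and of [b]
    for large [k]. *)
Definition plateau' k a b x : R := k * bump (k * (x - a)) - k * bump (k * (x - b)).

Lemma is_derive_plateau k a b x :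
  is_derive x 1 (plateau k a b) (plateau' k a b x).
Proof.
have ha := is_derive1_affine_comp (is_derive_smoothstep (k * (x - a))).
have hb := is_derive1_affine_comp (is_derive_smoothstep (k * (x - b))).
exact: is_deriveB.
Qed.

Lemma continuous_bump_affine k a : continuous (fun x => k * bump (k * (x - a))).
Proof.
move=> x; apply: cvgM; first exact: cvg_cst.
apply: (@continuous_comp _ _ _ (fun y => k * (y - a)) bump); last first.
  exact: continuous_bump.
by apply: cvgM; [exact: cvg_cst|apply: cvgB; [exact: cvg_id|exact: cvg_cst]].
Qed.

Lemma derive1_plateau k a b : derive1 (plateau k a b) = plateau' k a b.
Proof.
apply/funext => x; rewrite derive1E.
by have /@derive_val := is_derive_plateau k a b x.
Qed.

Lemma test_function_plateau k a b L : 0 < k -> 0 < a -> a <= b -> b + k^-1 < L ->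
  test_function L (plateau k a b).
Proof.
move=> k0 a0 ab bL; split.
- by move=> x; have [] := is_derive_plateau k a b x.
- rewrite derive1_plateau => x.
  by apply: cvgB; exact: continuous_bump_affine.
(* Left of [a] both steps are 0, and right of [b + k^-1] both are 1, so they cancel outside this
   interval. *)
- exists a, (b + k^-1); split => // x.
  rewrite in_itv/= negb_and -!ltNge => /orP[xa|bx]; rewrite /plateau.
    rewrite !smoothstep_le0 ?subrr// pmulr_rle0// subr_le0 ltW//.
    exact: lt_le_trans xa ab.
  have xb : 1 <= k * (x - b).
    by rewrite -ler_pdivrMl// mulr1; lra.
  by rewrite !smoothstep_ge1 ?subrr// (le_trans xb)// ler_pM2l// lerD2l lerN2.
Qed.

Lemma plateau_itv k a b x : 0 <= k -> a <= b -> `|plateau k a b x| <= 1.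
Proof.
move=> k0 ab; rewrite /plateau ler_norml.
have := smoothstep_itv (k * (x - a)); have := smoothstep_itv (k * (x - b)); lra.
Qed.

(** For x > a the scaled argument eventually exceeds 1. At [a] itself it is 0, where [smoothstep]
    vanishes; hence the half-line is open at [a]. *)
Lemma cvg_smoothstep a x :
  smoothstep (n.+1%:R * (x - a)) @[n --> \oo] --> (\1_(`]a, +oo[%classic) x : R).
Proof.
rewrite indicE; case: (ltP a x) => xa.
  rewrite mem_set/=; last by rewrite in_itv/= xa.
  apply: cvg_near_cst; near=> n.
  apply: smoothstep_ge1; rewrite -ler_pdivrMr ?subr_gt0// mul1r.
  apply: (@le_trans _ _ n%:R); last by rewrite ler_nat.
  near: n; exact: nbhs_infty_ger.
rewrite memNset/=; last by rewrite in_itv/= andbT; apply/negP; rewrite -leNgt.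
under eq_fun do rewrite smoothstep_le0 ?mulr_ge0_le0 ?subr_le0//.
exact: cvg_cst.
Unshelve. all: end_near. Qed.

End smoothstep.

(** * Approximate identities on [0, L] *)

Section mollification.
Context {R : realType}.
Notation mu := (@lebesgue_measure R).
Implicit Types (f g : R -> R) (a b k L : R).

Lemma within_continuousM (A : set R) f g :
  {within A, continuous f} -> {within A, continuous g} ->
  {within A, continuous (fun x => f x * g x)}.
Proof. by move=> cf cg x; apply: cvgM; [exact: cf|exact: cg]. Qed.

Lemma within_continuousB (A : set R) f g :
  {within A, continuous f} -> {within A, continuous g} ->
  {within A, continuous (fun x => f x - g x)}.
Proof. by move=> cf cg x; apply: cvgB; [exact: cf|exact: cg]. Qed.

Lemma integrable_within_continuous a b f : {within `[a, b], continuous f} ->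
  mu.-integrable `[a, b] (EFin \o f).
Proof. by apply: continuous_compact_integrable; exact: segment_compact. Qed.

(** The support [a, a + 1/k] lies inside [0, L], so the antiderivative climbs all the way from 0 to
    1. *)
Lemma Rintegral_bump L a k : 0 < a -> 0 < k -> a + k^-1 < L ->
  \int[mu]_(x in `[0, L]) (k * bump (k * (x - a))) = 1.
Proof.
move=> a0 k0 aL; have ki : 0 < k^-1 by rewrite invr_gt0.
pose F x := smoothstep (k * (x - a)).
have dF (x : R) : is_derive x 1 F (k * bump (k * (x - a))).
  exact: is_derive1_affine_comp (is_derive_smoothstep _).
have cF : continuous F.
  move=> x; apply: differentiable_continuous; apply/derivable1_diffP.
  by have [] := dF x.
rewrite /Rintegral (@continuous_FTC2 _ _ F); last 4 first.
- lra.
- by apply: continuous_subspaceT; exact: continuous_bump_affine.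
- split=> [x _||]; first by have [] := dF x.
  + exact/cvg_at_right_filter/cF.
  + exact/cvg_at_left_filter/cF.
- by move=> x _; rewrite derive1E; exact: derive_val.
rewrite /F /= smoothstep_ge1 ?smoothstep_le0 ?subr0//.
  by rewrite pmulr_rle0//; lra.
by rewrite -ler_pdivrMl// mulr1; lra.
Qed.

(** The scaled bumps are nonnegative, have mass one and shrink to [a] from the right, so the
    integral is an average of values of [f] near [a]. *)
Lemma cvg_Rintegral_bump L f a : 0 < a < L -> {within `[0, L], continuous f} ->
  \int[mu]_(x in `[0, L]) (f x * (n.+1%:R * bump (n.+1%:R * (x - a))))
    @[n --> \oo] --> f a.
Proof.
move=> /andP[a0 aL] cf; have L0 := lt_trans a0 aL.
pose h n x : R := n.+1%:R * bump (n.+1%:R * (x - a)).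
have ch n : {within `[0, L], continuous (h n)}.
  by apply: continuous_subspaceT; exact: continuous_bump_affine.
have h0 n x : 0 <= h n x by rewrite /h mulr_ge0// bump_ge0.
apply/cvgrPdist_le => e e0.
have /(continuous_within_itvP _ L0)[cfi _ _] := cf.
have /cfi/cvgrPdist_le/(_ _ e0) [d /= d0 hd] : a \in `]0, L[.
  by rewrite in_itv/= a0.
near=> n.
have nd : n.+1%:R^-1 < d.
  by near: n; exact: near_infty_natSinv_lt (PosNum d0).
have nL : a + n.+1%:R^-1 < L.
  rewrite -ltrBrDl; near: n.
  have aL0 : 0 < L - a by rewrite subr_gt0.
  exact: near_infty_natSinv_lt (PosNum aL0).
(* The bump vanishes outside ]a, a + 1/(n+1)[; inside, [x] is within [d] of [a] and continuity gives
   the bound. *)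
have hh x : `|(f a - f x) * h n x| <= e * h n x.
  rewrite normrM (ger0_norm (h0 n x)).
  have [xa|xa] := leP x a.
    by rewrite /h bump_eq0 ?mulr0//; left; rewrite pmulr_rle0// subr_le0.
  have [xd|xd] := leP n.+1%:R^-1 (x - a).
    by rewrite /h bump_eq0 ?mulr0//; right; rewrite -ler_pdivrMl// mulr1.
  apply: ler_wpM2r => //; apply: hd => /=.
  by rewrite distrC gtr0_norm ?subr_gt0// (lt_trans xd).
have cfh : {within `[0, L], continuous (fun x => f x * h n x)}.
  exact: within_continuousM.
have ck (k : R) : {within `[0, L], continuous (fun x => k * h n x)}.
  by apply: within_continuousM => // x; exact: cvg_cst.
have I1 : \int[mu]_(x in `[0, L]) h n x = 1 by exact: Rintegral_bump.
(* Unit mass allows [f a] to be moved under the integral. *)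
have -> : f a - \int[mu]_(x in `[0, L]) (f x * h n x) =
    \int[mu]_(x in `[0, L]) ((f a - f x) * h n x).
  under [RHS]eq_Rintegral do rewrite mulrBl.
  rewrite RintegralB//; try exact: integrable_within_continuous.
  by rewrite RintegralZl// ?I1 ?mulr1//; exact: integrable_within_continuous.
have cd : {within `[0, L], continuous (fun x => (f a - f x) * h n x)}.
  apply: within_continuousM => //; apply: within_continuousB => // x.
  exact: cvg_cst.
apply: le_trans (le_normr_Rintegral _ _) _ => //.
  exact: integrable_within_continuous.
rewrite -[leRHS]mulr1 -I1 -RintegralZl//; last exact: integrable_within_continuous.
apply: le_Rintegral => //.
- by apply: integrable_norm; exact: integrable_within_continuous.
- exact: integrable_within_continuous.
Unshelve. all: end_near. Qed.

End mollification.

(** * The fundamental theorem of calculus in H^1 *)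

Section weak_derivative_FTC.
Context {R : realType}.
Notation mu := (@lebesgue_measure R).
Variables (L : R) (f df : R -> R).
Implicit Types (a b x : R).
Hypotheses (cf : {within `[0, L], continuous f})
  (idf : mu.-integrable `[0, L] (EFin \o df))
  (wdf : forall phi, test_function L phi ->
    \int[mu]_(z in `[0, L]) (f z * derive1 phi z) =
    - \int[mu]_(z in `[0, L]) (df z * phi z)).

(** Dominated convergence with bound |df|, since plateaus take values in [-1, 1]. *)
Lemma cvg_Rintegral_plateau a b : 0 < a -> a <= b -> b < L ->
  \int[mu]_(z in `[0, L]) (df z * plateau n.+1%:R a b z) @[n --> \oo] -->
  \int[mu]_(z in `]a, b]) df z.
Proof.
move=> a0 ab bL.
have mdf : measurable_fun `[0, L] df.
  by move: idf => /integrableP[/measurable_EFinP].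
have mp (n : nat) : measurable_fun `[0, L] (plateau n.+1%:R a b).
  apply: measurable_funTS; apply: continuous_measurable_fun => x.
  apply: differentiable_continuous; apply/derivable1_diffP.
  by have [] := is_derive_plateau n.+1%:R a b x.
(* The pointwise limit of the plateaus, which is the indicator of ]a, b]. *)
pose l (z : R) : R := \1_(`]a, +oo[%classic) z - \1_(`]b, +oo[%classic) z.
have lE z : df z * l z = (df \_ `]a, b]) z.
  rewrite /l !indicE patchE !mem_setE !in_itv/= !andbT.
  have [za|za] := ltP a z; have [zb|zb] := ltP b z;
    rewrite /= ?subrr ?subr0 ?mulr0 ?mulr1//.
  by move: (lt_le_trans zb za); rewrite ltNge ab.
have sub : `]a, b] `<=` `[0, L].
  by apply: subset_itv; rewrite bnd_simp ltW.
have [|||||H0 _ H] := @dominated_convergence _ _ R mu `[0, L] (measurable_itv _)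
  (fun n z => (df z * plateau n.+1%:R a b z)%:E)
  (fun z => ((df \_ `]a, b]) z)%:E) (fun z => `|df z|%:E).
- by move=> n; apply/measurable_EFinP; apply: measurable_funM; [exact: mdf|exact: mp].
- apply/measurable_EFinP; apply/measurable_restrict => //.
  by rewrite (setIidr sub); exact: measurable_funS mdf.
- apply: aeW => z _; rewrite -lE; apply: cvg_EFin; first exact: nearW.
  apply: cvgM; first exact: cvg_cst.
  by apply: cvgB; exact: cvg_smoothstep.
- exact: integrable_norm.
- apply: aeW => z n _; rewrite lee_fin normrM ler_piMr//.
  exact: plateau_itv.
have -> : \int[mu]_(z in `]a, b]) df z = \int[mu]_(z in `[0, L]) ((df \_ `]a, b]) z).
  by rewrite -Rintegral_mkcondr; congr Rintegral; rewrite setIidr.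
by apply: fine_cvg; rewrite fineK//; exact: integrable_fin_num H0.
Qed.

(** Testing the weak derivative against plateaus: the side with [f] tends to f(a) - f(b) by
    mollification, the side with [df] to minus the integral over ]a, b]. *)
Lemma weak_derivative_increment a b : 0 < a -> a <= b -> b < L ->
  f b - f a = \int[mu]_(z in `]a, b]) df z.
Proof.
move=> a0 ab bL.
have b0 := lt_le_trans a0 ab; have aL := le_lt_trans ab bL.
refine (norm_cvg_unique _ (cvg_Rintegral_plateau a0 ab bL)).
have lim : \int[mu]_(z in `[0, L]) (f z * (n.+1%:R * bump (n.+1%:R * (z - a)))) -
  \int[mu]_(z in `[0, L]) (f z * (n.+1%:R * bump (n.+1%:R * (z - b))))
    @[n --> \oo] --> f a - f b.
  by apply: cvgB; apply: cvg_Rintegral_bump; rewrite ?a0 ?b0.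
rewrite /= -[f b - f a]opprB; apply: cvg_trans (cvgN lim); apply: near_eq_cvg.
(* Only for large [n] does the support [a, b + 1/(n+1)] stay below [L], making the plateau a test
   function. *)
near=> n.
have bn : b + n.+1%:R^-1 < L.
  rewrite -ltrBrDl; near: n.
  have bL0 : 0 < L - b by rewrite subr_gt0.
  exact: near_infty_natSinv_lt (PosNum bL0).
have cb c : {within `[0, L], continuous
    (fun x => f x * (n.+1%:R * bump (n.+1%:R * (x - c))))}.
  apply: within_continuousM => //; apply: continuous_subspaceT.
  exact: continuous_bump_affine.
rewrite /= -[LHS]/(- (_ - _)) -RintegralB//; try exact: integrable_within_continuous.
rewrite -[RHS]opprK; congr (- _).
rewrite -wdf; last by apply: test_function_plateau.
by apply: eq_Rintegral => z _; rewrite derive1_plateau /plateau' [RHS]mulrBr.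
Unshelve. all: end_near. Qed.

(** The increment formula holds strictly inside ]0, L[, as supports of test functions must;
    continuity carries it to the endpoints. *)
Lemma weak_derivative_FTC x : 0 <= x <= L ->
  f x = f 0 + \int[mu]_(z in `[0, x]) df z.
Proof.
move=> /andP[x0 xL].
have [L0|L0] := eqVneq L 0.
  have -> : x = 0 by apply/eqP; rewrite eq_le x0 -L0 xL.
  by rewrite set_itv1 Rintegral_set1 addr0.
have {}L0 : 0 < L by rewrite lt_neqAle eq_sym L0 (le_trans x0).
(* This defect is continuous on [0, L] and constant on ]0, L[; the midpoint [L / 2] serves as
   reference value. *)
pose e y := f y - \int[mu]_(z in `[0, y]) df z.
have ce : {within `[0, L], continuous e}.
  apply: within_continuousB => //.
  by apply: parameterized_integral_continuous => //; exact: ltW.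
have ee a b : 0 < a -> a <= b -> b < L -> e a = e b.
  move=> a0 ab bL; apply/eqP; rewrite -subr_eq0 /e.
  have := weak_derivative_increment a0 ab bL.
  rewrite -(@Rintegral_itvB _ df (BLeft 0) (BRight b) a).
  - by move=> h; apply/eqP; lra.
  - by apply: integrableS idf => //; apply: subset_itvl; rewrite bnd_simp ltW.
  - by rewrite bnd_simp ltW.
  - by rewrite bnd_simp.
have ec y : 0 < y < L -> e y = e (L / 2).
  move=> /andP[y0 yL]; have [yh|/ltW yh] := leP y (L / 2).
    by apply: ee => //; lra.
  by apply/esym/ee => //; lra.
have /(continuous_within_itvP _ L0)[_ e0 eL] := ce.
have e0c : e 0 = e (L / 2).
  refine (norm_cvg_unique e0 _).
  apply: cvg_near_cst; near=> y; apply: ec; apply/andP; split; near: y.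
    exact: nbhs_right_gt.
  exact: nbhs_right_lt.
have eLc : e L = e (L / 2).
  refine (norm_cvg_unique eL _).
  apply: cvg_near_cst; near=> y; apply: ec; apply/andP; split; near: y.
    exact: nbhs_left_gt.
  exact: nbhs_left_lt.
have : e x = e 0.
  rewrite e0c; move: x0; rewrite le_eqVlt => /predU1P[<-//|x0].
  by move: xL; rewrite le_eqVlt => /predU1P[->//|xL]; rewrite ec ?x0.
rewrite /e set_itv1 Rintegral_set1; lra.
Unshelve. all: end_near. Qed.

End weak_derivative_FTC.

(** * Fubini on a triangle and integration by parts *)

Lemma integrable_prod_fun d1 d2 (T1 : measurableType d1) (T2 : measurableType d2)
    (R : realType) (m1 : {sigma_finite_measure set T1 -> \bar R})
    (m2 : {sigma_finite_measure set T2 -> \bar R}) (a : T1 -> R) (b : T2 -> R) :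
  m1.-integrable setT (EFin \o a) -> m2.-integrable setT (EFin \o b) ->
  (m1 \x m2)%E.-integrable setT (fun z : T1 * T2 => (a z.1 * b z.2)%:E).
Proof.
move=> /[dup] ia /integrableP[/measurable_EFinP ma ai].
move=> /[dup] ib /integrableP[/measurable_EFinP mb bi].
apply/integrable12ltyP.
  by apply/measurable_EFinP; apply: measurable_funM; apply: measurableT_comp.
have ib' := integrable_fin_num measurableT (integrable_abse ib).
(* By Tonelli the iterated integral of the absolute value factors; the inner integral of |b| is
   finite, so it can be pulled out as a real constant. *)
under eq_integral => x _.
  under eq_integral do rewrite /= normrM EFinM.
  rewrite ge0_integralZl//; last exact/measurable_EFinP/measurableT_comp.
  rewrite -[X in (_ * X)%E]fineK ?ib'// muleC.
  over.
rewrite ge0_integralZl//.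
- rewrite fineK//; apply: lte_mul_pinfty => //; exact: integral_ge0.
- exact/measurable_EFinP/measurableT_comp.
- by rewrite lee_fin; apply: fine_ge0; exact: integral_ge0.
Qed.

Section integration_by_parts.
Context {R : realType}.
Notation mu := (@lebesgue_measure R).
Implicit Types (a b f g df dg : R -> R) (L : R).

(** Both sides are iterated integrals of a(s) b(t) over the triangle s <= t, taken in the two
    orders. *)
Lemma Rintegral_triangle a b :
  mu.-integrable setT (EFin \o a) -> mu.-integrable setT (EFin \o b) ->
  \int[mu]_s (a s * \int[mu]_(t in `[s, +oo[) b t) =
  \int[mu]_t (b t * \int[mu]_(s in `]-oo, t]) a s).
Proof.
move=> ia ib.
have /integrableP[/measurable_EFinP ma ai] := ia.
have /integrableP[/measurable_EFinP mb bi] := ib.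
pose T := [set z : R * R | z.1 <= z.2].
have mT : measurable T.
  by rewrite -[T]setTI; apply: measurable_fun_le.
have TE s t : ((s, t) \in T) = (s <= t) by apply/idP/idP; rewrite inE.
(* Extension by 0 off the triangle gives a function on the whole plane, dominated by the integrable
   product of [a] and [b]. *)
pose F (z : R * R) : \bar R := (a z.1 * b z.2 * \1_T z)%:E.
have iF : (mu \x mu)%E.-integrable setT F.
  apply: le_integrable (integrable_prod_fun ia ib) => //.
    apply/measurable_EFinP; apply: measurable_funM.
      by apply: measurable_funM; apply: measurableT_comp.
    exact: measurable_indic.
  move=> z _; rewrite /F /= lee_fin normrM ler_piMr// indicE.
  by case: (_ \in _); rewrite ?normr1 ?normr0.
have ix (A : set R) c : measurable A -> mu.-integrable setT (EFin \o c) ->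
    mu.-integrable A (EFin \o c).
  by move=> mA; apply: integrableS.
have HF := Fubini iF; congr fine.
transitivity (\int[mu]_x \int[mu]_y F (x, y))%E.
  apply: eq_integral => s _.
  have /integrable_fin_num fb := ix _ _ (measurable_itv `[s, +oo[) ib.
  rewrite EFinM fineK ?fb// -integralZl//; last exact: ix.
  rewrite integral_mkcond; apply: eq_integral => t _.
  rewrite patchE /F /= indicE TE mem_setE in_itv/= andbT.
  by case: ifPn => _; rewrite ?mulr1 ?mulr0.
rewrite HF; apply: eq_integral => t _.
have /integrable_fin_num fa := ix _ _ (measurable_itv `]-oo, t]) ia.
rewrite EFinM fineK ?fa// -integralZl//; last exact: ix.
rewrite [RHS]integral_mkcond; apply: eq_integral => s _.
rewrite patchE /F /= indicE TE mem_setE in_itv/=.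
by case: ifPn => _; rewrite ?mulr1 ?mulr0// mulrC.
Qed.

(** Apply the triangle identity to [df] and [dg] extended by 0: the inner integrals become g(L) -
    g(s) and f(t) - f(0), and expanding gives the formula. *)
Lemma Rintegral_by_parts L f df g dg : 0 <= L ->
  mu.-integrable `[0, L] (EFin \o df) -> mu.-integrable `[0, L] (EFin \o dg) ->
  (forall x, 0 <= x <= L -> f x = f 0 + \int[mu]_(z in `[0, x]) df z) ->
  (forall x, 0 <= x <= L -> g x = g 0 + \int[mu]_(z in `[0, x]) dg z) ->
  mu.-integrable `[0, L] (EFin \o (fun z => df z * g z)) ->
  mu.-integrable `[0, L] (EFin \o (fun z => dg z * f z)) ->
  \int[mu]_(z in `[0, L]) (df z * g z) + \int[mu]_(z in `[0, L]) (dg z * f z) =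
  f L * g L - f 0 * g 0.
Proof.
move=> L0 idf idg fE gE idfg idgf.
have ext h : mu.-integrable `[0, L] (EFin \o h) ->
    mu.-integrable setT (EFin \o (h \_ `[0, L])).
  by move=> ih; rewrite -restrict_EFin; apply/integrable_restrict; rewrite ?setTI.
have := Rintegral_triangle (ext _ idf) (ext _ idg).
have -> : \int[mu]_s ((df \_ `[0, L]) s *
      \int[mu]_(t in `[s, +oo[) (dg \_ `[0, L]) t) =
    \int[mu]_(s in `[0, L]) (df s * (g L - g s)).
  rewrite [RHS]Rintegral_mkcond; apply: eq_Rintegral => s _.
  rewrite !patchE; case: ifPn; last by rewrite mul0r.
  rewrite mem_setE in_itv/= => /andP[s0 sL]; congr (_ * _).
  rewrite -Rintegral_mkcondr.
  have -> : `[s, +oo[ `&` `[0, L] = `[s, L]%classic.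
    apply/seteqP; split => x /=; rewrite !in_itv/= andbT; last first.
      by move=> /andP[sx xL]; rewrite sx xL (le_trans s0).
    by move=> [-> /andP[_ ->]].
  rewrite (gE L) ?L0 ?lexx// (gE s) ?s0// opprD addrACA subrr add0r.
  (* The difference of integrals lives on ]s, L]; adding the null point [s] closes the interval. *)
  rewrite Rintegral_itvB ?bnd_simp//.
  rewrite Rintegral_itv_obnd_cbnd//.
  by apply: integrableS idg => //; apply: subset_itvr; rewrite bnd_simp.
have -> : \int[mu]_t ((dg \_ `[0, L]) t *
      \int[mu]_(s in `]-oo, t]) (df \_ `[0, L]) s) =
    \int[mu]_(t in `[0, L]) (dg t * (f t - f 0)).
  rewrite [RHS]Rintegral_mkcond; apply: eq_Rintegral => t _.
  rewrite !patchE; case: ifPn; last by rewrite mul0r.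
  rewrite mem_setE in_itv/= => /andP[t0 tL]; congr (_ * _).
  rewrite -Rintegral_mkcondr.
  have -> : `]-oo, t] `&` `[0, L] = `[0, t]%classic.
    apply/seteqP; split => x /=; rewrite !in_itv/=; last first.
      by move=> /andP[x0 xt]; rewrite xt x0 (le_trans xt).
    by move=> [-> /andP[-> _]].
  by rewrite (fE t) ?t0// addrC addKr.
have Zr h c : mu.-integrable `[0, L] (EFin \o h) ->
    mu.-integrable `[0, L] (EFin \o (fun z => h z * c)).
  move=> ih; rewrite (_ : _ \o _ = (fun z => (EFin \o h) z * cst c%:E z)%E)//.
  exact: integrableZr.
under eq_Rintegral do rewrite mulrBr.
rewrite RintegralB//; last exact: Zr.
under [in X in _ = X -> _]eq_Rintegral do rewrite mulrBr.
rewrite RintegralB//; last exact: Zr.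
rewrite !RintegralZr//.
have := fE L; have := gE L; rewrite L0 lexx => /(_ isT) gL /(_ isT) fL.
have -> : \int[mu]_(x in `[0, L]) df x = f L - f 0 by rewrite fL addrC addKr.
have -> : \int[mu]_(x in `[0, L]) dg x = g L - g 0 by rewrite gL addrC addKr.
lra.
Qed.

End integration_by_parts.

(** * Square integrable functions *)

Section square_integrable.
Context {R : realType}.
Notation mu := (@lebesgue_measure R).
Implicit Types (f g : R -> R) (L : R).
Local Notation L2 L f := ((f \_ `[0, L]) \in Lfun mu 2%:E).

Lemma L2_lincomb L f g (a b : R) : L2 L f -> L2 L g ->
  L2 L (fun z => a * f z + b * g z).
Proof.
move=> f2 g2.
have [_ lin] := @Lfun_submod_closed _ _ R mu 2%:E (lee1n 2).
(* Submodule closure has the form a u + v, whence the trailing zero function. *)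
have -> : (fun z => a * f z + b * g z) \_ `[0, L] =
    a *: (f \_ `[0, L]) + (b *: (g \_ `[0, L]) + 0).
  apply/funext => z; rewrite addr0 !fctE !patchE /GRing.scale/=.
  by case: ifPn => _; rewrite ?mulr0 ?addr0.
apply: (lin) => //; apply: (lin) => //.
by have [] := @Lfun_submod_closed _ _ R mu 2%:E (lee1n 2).
Qed.

(** Holds because [0, L] has finite measure. Paired with the product lemma it makes square
    integrable functions integrable. *)
Lemma L2_cst1 L : L2 L (fun=> 1 : R).
Proof.
have -> : (fun=> 1 : R) \_ `[0, L] = \1_(`[0, L]%classic).
  by apply/funext => z; rewrite patchE indicE; case: ifPn.
rewrite inE; apply/andP; split; rewrite inE/=; first exact: measurable_indic.
rewrite /finite_norm unlock poweR_lty//.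
rewrite [ltLHS](_ : _ = \int[mu]_z (\1_(`[0, L]%classic) z)%:E)%E; last first.
  apply: eq_integral => z _ /=; rewrite ger0_norm ?indicE ?ler0n//.
  by case: (_ \in _); rewrite ?powR1 ?powR0// pnatr_eq0.
rewrite integral_indic// setIT; have := lebesgue_measure_itv `[0, L].
by move=> /= ->; case: ifP => _; rewrite ?ltry// -EFinB ltry.
Qed.

Lemma L2_integrableM L f g : L2 L f -> L2 L g ->
  mu.-integrable `[0, L] (EFin \o (fun z => f z * g z)).
Proof.
move=> f2 g2; have := Lfun2_mul_Lfun1 f2 g2.
rewrite Lfun1_integrable => fg; rewrite -[`[0, L]%classic]setTI.
apply/integrable_restrict => //.
have -> : (EFin \o (fun z => f z * g z)) \_ `[0, L] =
    EFin \o ((f \_ `[0, L]) \* (g \_ `[0, L])).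
  rewrite restrict_EFin; congr (_ \o _); apply/funext => z /=.
  by rewrite !patchE; case: ifPn => _; rewrite ?mulr0.
exact: fg.
Qed.

Lemma L2_integrable L f : L2 L f -> mu.-integrable `[0, L] (EFin \o f).
Proof.
move=> f2; have := L2_integrableM f2 (L2_cst1 L).
by congr (_ .-integrable _ _); apply/funext => z /=; rewrite mulr1.
Qed.

Lemma L2_cauchy_schwarz L f g : L2 L f -> L2 L g ->
  (`|\int[mu]_(z in `[0, L]) (f z * g z)|%:E <= L2_norm L f * L2_norm L g)%E.
Proof.
move=> f2 g2.
have mf : measurable_fun setT (f \_ `[0, L]).
  by move: f2; rewrite inE => /andP[/[!inE]].
have mg : measurable_fun setT (g \_ `[0, L]).
  by move: g2; rewrite inE => /andP[/[!inE]].
have H : ('N[mu]_1%:E[EFin \o ((f \_ `[0, L]) \* (g \_ `[0, L]))%R] <=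
    L2_norm L f * L2_norm L g)%E.
  by apply: (@hoelder _ _ R mu _ _ 2 2) => //; rewrite [RHS]splitr !div1r.
apply: le_trans H.
have ifg := L2_integrableM f2 g2.
rewrite EFin_normr_Rintegral// Lnorm1.
apply: le_trans (le_abse_integral _ _ _) _ => //; first exact: measurable_int ifg.
rewrite [leLHS]integral_mkcond; rewrite le_eqVlt; apply/orP; left; apply/eqP.
apply: eq_integral => z _; rewrite !patchE /= !patchE.
by case: ifPn => _; rewrite ?mulr0 ?normr0.
Qed.

(** Strong convergence implies weak convergence, by Cauchy-Schwarz. This carries difference
    quotients of the plant state to the limit under the integral. *)
Lemma L2_cvg_RintegralM (T : Type) (F : set_system T) (FF : Filter F) L g
    (q : T -> R -> R) (l : R -> R) :
  L2 L g -> L2 L l -> (\forall s \near F, L2 L (q s)) ->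
  L2_norm L (fun z => q s z - l z) @[s --> F] --> 0%E ->
  \int[mu]_(z in `[0, L]) (g z * q s z) @[s --> F] -->
  \int[mu]_(z in `[0, L]) (g z * l z).
Proof.
move=> g2 l2 q2 ql.
have gfin : L2_norm L g \is a fin_num.
  rewrite ge0_fin_numE ?Lnorm_ge0//.
  by move: g2; rewrite inE => /andP[_ /[!inE]].
have {ql}gql :
    (L2_norm L g * L2_norm L (fun z => q s z - l z)%R)%E @[s --> F] --> 0%E.
  rewrite -(mule0 (L2_norm L g)); exact: cvgeZl.
apply/cvgrPdist_le => e e0.
have /fine_cvgP[fing /cvgrPdist_le/(_ _ e0)] := gql.
apply: filterS3 fing q2 => s; rewrite sub0r normrN => fin qs ge.
have ql2 : L2 L (fun z => q s z - l z).
  have := L2_lincomb 1 (-1) qs l2.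
  by under [X in X \_ _]eq_fun do rewrite mul1r mulN1r.
rewrite distrC -RintegralB//; [|exact: L2_integrableM..].
under eq_Rintegral do rewrite -mulrBr.
rewrite -lee_fin; apply: le_trans (L2_cauchy_schwarz g2 ql2) _.
by rewrite -[leLHS]fineK// lee_fin (le_trans (ler_norm _)).
Qed.

End square_integrable.

(** * Matrix bilinear forms of vector-valued functions *)

Section vector_valued.
Context {R : realType}.
Notation mu := (@lebesgue_measure R).
Implicit Types (L : R).

Lemma integrable_EFin_sum (I : Type) (s : seq I) (D : set R) (h : I -> R -> R) :
  measurable D -> (forall i, mu.-integrable D (EFin \o h i)) ->
  mu.-integrable D (EFin \o (fun z => \sum_(i <- s) h i z)).
Proof.
move=> mD ih.
rewrite (_ : _ \o _ = (fun z => \sum_(j <- s) (EFin \o h j) z)%E).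
  by apply: integrable_sum => // j _; exact: ih.
by apply/funext => z /=; rewrite sumEFin.
Qed.

Lemma Rintegral_sum (I : Type) (s : seq I) (D : set R) (h : I -> R -> R) :
  measurable D -> (forall i, mu.-integrable D (EFin \o h i)) ->
  \int[mu]_(z in D) (\sum_(i <- s) h i z) =
  \sum_(i <- s) \int[mu]_(z in D) h i z.
Proof.
move=> mD ih; elim: s => [|i s IH].
  rewrite big_nil; under eq_Rintegral do rewrite big_nil.
  by rewrite Rintegral_cst// mul0r.
rewrite big_cons -IH -RintegralD//; last exact: integrable_EFin_sum.
by under eq_Rintegral do rewrite big_cons.
Qed.

(** Reduces integrals of bilinear forms to integrals of products of two scalar coordinates. *)
Lemma bilinear_mxE n p (M : 'M[R]_(n, p)) (x : 'cV[R]_n) (y : 'cV[R]_p) :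
  (x^T *m M *m y) 0 0 = \sum_i \sum_j M i j * (x i 0 * y j 0).
Proof.
rewrite mxE exchange_big; apply: eq_bigr => j _; rewrite mxE big_distrl.
by apply: eq_bigr => i _; rewrite mxE /=; ring.
Qed.

Section bilinear.
Variables (n p : nat) (M : 'M[R]_(n, p)) (L : R).
Variables (x : R -> 'cV[R]_n) (y : R -> 'cV[R]_p).
Hypotheses (x2 : is_L2 L x) (y2 : is_L2 L y).

Let integrable_coord i j :
  mu.-integrable `[0, L] (EFin \o (fun z => x z i 0 * y z j 0)).
Proof. exact: L2_integrableM. Qed.

Let integrable_entry i j :
  mu.-integrable `[0, L] (EFin \o (fun z => M i j * (x z i 0 * y z j 0))).
Proof.
rewrite (_ : _ \o _ = fun z => ((M i j)%:E * (x z i 0 * y z j 0)%:E)%E)//.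
by apply: integrableZl => //; exact: integrable_coord.
Qed.

Lemma integrable_bilinear_mx :
  mu.-integrable `[0, L] (EFin \o (fun z => ((x z)^T *m M *m y z) 0 0)).
Proof.
under [X in EFin \o X]eq_fun do rewrite bilinear_mxE.
by do 2 (apply: integrable_EFin_sum => // ?).
Qed.

Lemma Rintegral_bilinear_mx :
  \int[mu]_(z in `[0, L]) ((x z)^T *m M *m y z) 0 0 =
  \sum_i \sum_j M i j * \int[mu]_(z in `[0, L]) (x z i 0 * y z j 0).
Proof.
under eq_Rintegral do rewrite bilinear_mxE.
rewrite Rintegral_sum// => [|i]; last exact: integrable_EFin_sum.
apply: eq_bigr => i _; rewrite Rintegral_sum//; apply: eq_bigr => j _.
by rewrite RintegralZl.
Qed.

End bilinear.

Lemma is_H1_coord n L (f df : R -> 'cV[R]_n) i : is_H1 L f df ->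
  {within `[0, L], continuous (fun z => f z i 0)}.
Proof.
move=> [cf _ _ _] z; apply: (@continuous_comp _ _ _ (f : subspace `[0, L] -> _)
  (fun v : 'cV[R]_n => v i 0)); first exact: cf.
exact: coord_continuous.
Qed.

Lemma is_H1_FTC n L (f df : R -> 'cV[R]_n) i x : is_H1 L f df -> 0 <= x <= L ->
  f x i 0 = f 0 i 0 + \int[mu]_(z in `[0, x]) df z i 0.
Proof.
move=> hf; have [_ _ df2 wdf] := hf.
apply: (@weak_derivative_FTC _ L (fun z => f z i 0) (fun z => df z i 0)).
- exact: is_H1_coord hf.
- exact: L2_integrable.
- by move=> phi /wdf; exact.
Qed.

(** The matrix is constant in [z], so the scalar formula applies to each pair of coordinates with
    weight [M i j]. *)
Lemma is_H1_by_parts n p (M : 'M[R]_(n, p)) L (x dx : R -> 'cV[R]_n)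
    (y dy : R -> 'cV[R]_p) : 0 <= L -> is_H1 L x dx -> is_H1 L y dy ->
  \int[mu]_(z in `[0, L]) ((dx z)^T *m M *m y z) 0 0 +
  \int[mu]_(z in `[0, L]) ((x z)^T *m M *m dy z) 0 0 =
  ((x L)^T *m M *m y L) 0 0 - ((x 0)^T *m M *m y 0) 0 0.
Proof.
move=> L0 hx hy; have [_ x2 dx2 _] := hx; have [_ y2 dy2 _] := hy.
rewrite !Rintegral_bilinear_mx// !bilinear_mxE -big_split -sumrB.
apply: eq_bigr => i _; rewrite -big_split -sumrB; apply: eq_bigr => j _ /=.
rewrite -mulrDr -mulrBr; congr (_ * _).
rewrite -(@Rintegral_by_parts _ L (fun z => x z i 0) (fun z => dx z i 0)
   (fun z => y z j 0) (fun z => dy z j 0))//.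
- by congr (_ + _); apply: eq_Rintegral => z _; rewrite mulrC.
- exact: L2_integrable.
- exact: L2_integrable.
- by move=> z; exact: is_H1_FTC.
- by move=> z; exact: is_H1_FTC.
- exact: L2_integrableM.
- exact: L2_integrableM.
Qed.

End vector_valued.

(** * Derivative of the Casimir functional *)

Section casimir.
Context {R : realType}.
Notation mu := (@lebesgue_measure R).

Lemma is_L2_difference_quotient p q L (f g : R -> 'M[R]_(p, q)) (a : R) :
  is_L2 L f -> is_L2 L g -> is_L2 L (fun z => a *: (f z - g z)).
Proof.
move=> f2 g2 i j; have := L2_lincomb a (- a) (f2 i j) (g2 i j).
rewrite (_ : (fun z => a * f z i j + - a * g z i j) =
  (fun z => (a *: (f z - g z)) i j))//.
by apply/funext => z; rewrite !mxE mulrBr mulNr.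
Qed.

(** The inserted identity matrix gives the density the shape of the bilinear lemmas. *)
Lemma casimirE n nc L (Gamma : 'cV[R]_nc) (Psi x : R -> 'cV[R]_n) v :
  casimir L Gamma Psi x v = (Gamma^T *m v) 0 0 +
    \int[mu]_(z in `[0, L]) ((Psi z)^T *m 1%:M *m x z) 0 0.
Proof. by congr (_ + _); apply: eq_Rintegral => z _; rewrite mulmx1. Qed.

(** The functional is linear in the pair of states, all integrals being finite. Differentiating it
    thus reduces to its continuity at the limit of the quotients. *)
Lemma casimir_difference_quotient n nc L (Gamma : 'cV[R]_nc)
    (Psi x y : R -> 'cV[R]_n) (v w : 'cV[R]_nc) (a : R) :
  is_L2 L Psi -> is_L2 L x -> is_L2 L y ->
  a * (casimir L Gamma Psi x v - casimir L Gamma Psi y w) =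
  casimir L Gamma Psi (fun z => a *: (x z - y z)) (a *: (v - w)).
Proof.
move=> P2 x2 y2; rewrite !casimirE.
have ix := integrable_bilinear_mx 1%:M P2 x2.
have iy := integrable_bilinear_mx 1%:M P2 y2.
have -> : \int[mu]_(z in `[0, L])
    ((Psi z)^T *m 1%:M *m (a *: (x z - y z))) 0 0 =
    a * (\int[mu]_(z in `[0, L]) ((Psi z)^T *m 1%:M *m x z) 0 0 -
         \int[mu]_(z in `[0, L]) ((Psi z)^T *m 1%:M *m y z) 0 0).
  rewrite -RintegralB// -RintegralZl//; last first.
    by apply: eq_integrable (integrableB _ ix iy).
  by apply: eq_Rintegral => z _; rewrite -scalemxAr mulmxBr !mxE.
by rewrite -scalemxAr mulmxBr !mxE; ring.
Qed.

Lemma derivative_within_casimir n nc L (Gamma : 'cV[R]_nc)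
    (Psi : R -> 'cV[R]_n) (J : set R) (chi chi' : R -> R -> 'cV[R]_n)
    (v v' : R -> 'cV[R]_nc) t :
  is_L2 L Psi -> is_C1_L2 L J chi chi' -> is_C1_on J v v' -> J t ->
  derivative_within J (fun s => casimir L Gamma Psi (chi s) (v s) : R^o) t
    (casimir L Gamma Psi (chi' t) (v' t)).
Proof.
move=> P2 Cchi [_ Cv] Jt; have [chit2 chi't2 dchi _] := Cchi t Jt.
pose q s z := (s - t)^-1 *: (chi s z - chi t z).
pose w s := (s - t)^-1 *: (v s - v t).
(* Staying in [J] keeps [chi s], hence the quotient [q s], square integrable. *)
have JF : \forall s \near within J t^', J s by exact: withinT.
have q2 : \forall s \near within J t^', is_L2 L (q s).
  apply: filterS JF => s Js; apply: is_L2_difference_quotient => //.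
  by have [] := Cchi s Js.
have lim : casimir L Gamma Psi (q s) (w s) @[s --> within J t^'] -->
    casimir L Gamma Psi (chi' t) (v' t).
  apply: cvgD.
    under eq_fun do rewrite mxE.
    rewrite mxE; apply: cvg_big => [x|i _]; first exact: add_continuous.
    apply: cvgM; first exact: cvg_cst.
    apply: (cvg_comp _ (fun x : 'cV[R]_nc => x i 0) (Cv t Jt)).
    exact: coord_continuous.
  (* In coordinates the distributed term is a finite sum of scalar pairings with the entries of
     [Psi], each continuous for L^2 convergence. *)
  have E (x : R -> 'cV[R]_n) : is_L2 L x ->
      \int[mu]_(z in `[0, L]) ((Psi z)^T *m x z) 0 0 =
      \sum_i \sum_j (1%:M : 'M[R]_n) i j *
        \int[mu]_(z in `[0, L]) (Psi z i 0 * x z j 0).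
    move=> x2; rewrite -(Rintegral_bilinear_mx 1%:M P2 x2).
    by under [RHS]eq_Rintegral do rewrite mulmx1.
  rewrite E//.
  apply: cvg_trans.
    apply: near_eq_cvg; apply: filterS q2 => s q2s; exact/esym/E.
  apply: cvg_big => [x|i _]; first exact: add_continuous.
  apply: cvg_big => [x|j _]; first exact: add_continuous.
  apply: cvgM; first exact: cvg_cst.
  apply: L2_cvg_RintegralM => //.
    by apply: filterS q2 => s; exact.
apply: cvg_trans lim; apply: near_eq_cvg.
apply: filterS JF => s Js; rewrite /= -casimir_difference_quotient//.
by have [] := Cchi s Js.
Qed.

End casimir.

(** * Algebra of the boundary form and of the power balance *)

Lemma portR_boundary_form (R : realType) n m k (L : R) (p : plant R n m k)
    (Q : R -> 'M[R]_n) (x : R -> 'cV[R]_n) (a b : 'cV[R]_n) :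
  symmetric_mx (P1 p) ->
  row_mx (e_bnd L p Q x)^T (f_bnd L p Q x)^T *m portR (P1 p) *m col_mx a b =
  (Q L *m x L)^T *m P1 p *m a - (Q 0 *m x 0)^T *m P1 p *m b.
Proof.
(* With S the swap of the two blocks, the identity is R^T S R = diag(P_1, -P_1), which relies on the
   symmetry of P_1. *)
rewrite /symmetric_mx /f_bnd /e_bnd /boundary_ports /portR => P1T.
move: (Q L *m x L) (Q 0 *m x 0) => y z; set r := (Num.sqrt 2)^-1.
have rr : r * r + r * r = 1 :> R.
  by rewrite -expr2 exprVn sqr_sqrtr//; lra.
rewrite -scalemxAl mul_block_col !mul1mx scale_col_mx col_mxKu col_mxKd.
rewrite -scalemxAr -scalemxAl mul_row_block mul_row_col !mulmx1.
rewrite !linearZ /= !linearD /= mulNmx linearN /= !trmx_mul P1T mulmxN.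
rewrite !(mulmxDl, mulNmx, scalerDr) -!scalemxAl !(mulmxDl, mulNmx).
(* The diagonal terms [A] and [B] occur twice, which absorbs the factor [r * r] = 1/2; the cross
   terms [C] and [D] cancel. *)
move: (y^T *m P1 p *m a) (z^T *m P1 p *m b) (z^T *m P1 p *m a)
  (y^T *m P1 p *m b) => A B C D.
transitivity ((r * r + r * r) *: (A - B)); last by rewrite rr scale1r.
by apply/matrixP => i j; rewrite !mxE; ring.
Qed.

(** Here [w] and [y] stand for Q chi and Q_c v_c. The energy matrices enter only through these, and
    the identity holds for arbitrary [w] and [y], whence the independence of the energies. *)
Lemma casimir_balance (R : realType) n m nc (P1 P0 G0 : 'M[R]_n)
    (B : 'M[R]_(n, m)) (Bc : 'M[R]_(nc, m)) (Gamma : 'cV[R]_nc)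
    (psi dpsi w dw : 'cV[R]_n) (y : 'cV[R]_nc) :
  symmetric_mx P1 -> skew_symmetric_mx P0 -> symmetric_mx G0 ->
  P1 *m dpsi + (P0 + G0) *m psi - B *m Bc^T *m Gamma = 0 ->
  Bc *m B^T *m psi = 0 ->
  psi^T *m (P1 *m dw + (P0 - G0) *m w + B *m - (Bc^T *m y))
    + Gamma^T *m Bc *m (B^T *m w)
  = dpsi^T *m P1 *m w + psi^T *m P1 *m dw.
Proof.
move=> P1T P0T G0T /eqP; rewrite subr_eq0 => /eqP cii ciii.
(* Transposed condition (iii): the controller feedback into the plant does not act on the
   functional. *)
have psiB : psi^T *m B *m Bc^T = 0.
  by apply: trmx_inj; rewrite !trmx_mul !trmxK mulmxA ciii trmx0.
(* Transposed condition (ii), where (P_0 + G_0)^T = -(P_0 - G_0): the controller input term cancels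
   the undifferentiated plant terms. *)
have dpsiP : Gamma^T *m Bc *m B^T = dpsi^T *m P1 - psi^T *m (P0 - G0).
  have := congr1 trmx cii.
  rewrite linearD /= !trmx_mul trmxK linearD /= P1T P0T G0T mulmxA => <-.
  by rewrite -mulmxN opprB; congr (_ + _ *m _); exact: addrC.
rewrite !mulmxDr !mulmxN !mulmxA psiB mul0mx oppr0 addr0 dpsiP mulmxBl.
by rewrite -!addrA [RHS]addrC; congr (_ + _); rewrite addrC subrK.
Qed.

Section row_integral.
Context {R : realType}.
Notation mu := (@lebesgue_measure R).

Lemma integrable_trmx_mul n m L (B : R -> 'M[R]_(n, m)) (w : R -> 'cV[R]_n) j :
  is_L2 L B -> is_L2 L w ->
  mu.-integrable `[0, L] (EFin \o (fun z => ((B z)^T *m w z) j 0)).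
Proof.
move=> B2 w2; under [X in EFin \o X]eq_fun do rewrite mxE.
apply: integrable_EFin_sum => // i; under [X in EFin \o X]eq_fun do rewrite mxE.
exact: L2_integrableM.
Qed.

Variables (m : nat) (D : set R) (g : 'rV[R]_m) (h : R -> 'cV[R]_m).
Hypotheses (mD : measurable D)
  (ih : forall j, mu.-integrable D (EFin \o (fun z => h z j 0))).

Let integrable_entry j : mu.-integrable D (EFin \o (fun z => g 0 j * h z j 0)).
Proof.
rewrite (_ : _ \o _ = fun z => ((g 0 j)%:E * (h z j 0)%:E)%E)//.
by apply: integrableZl => //; exact: ih.
Qed.

Lemma integrable_row_mul : mu.-integrable D (EFin \o (fun z => (g *m h z) 0 0)).
Proof.
under [X in EFin \o X]eq_fun do rewrite mxE.
exact: integrable_EFin_sum.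
Qed.

(** With [g] equal to Gamma^T B_c, this puts the averaged plant output fed to the controller under
    the integral over [0, L]. *)
Lemma Rintegral_row_mul : \int[mu]_(z in D) (g *m h z) 0 0 =
  (g *m \col_j \int[mu]_(z in D) h z j 0) 0 0.
Proof.
under eq_Rintegral do rewrite mxE.
rewrite Rintegral_sum// mxE; apply: eq_bigr => j _.
by rewrite mxE RintegralZl.
Qed.

End row_integral.

(** * Invariance along closed-loop solutions *)

Theorem proposition3 (R : realType) (n m k nc : nat) (L : R)
    (p : plant R n m k) (c : controller R nc m)
    (Gamma : 'cV[R]_nc) (Psi dPsi : R -> 'cV[R]_n)
    (L_gt0 : 0 < L)
    (hp : plant_assumptions L p)
    (hc : controller_assumptions c)
    (hPsi : is_H1 L Psi dPsi)
    (cond_i : (Ac c + Sc c) *m Gamma = 0)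
    (cond_ii : {ae @lebesgue_measure R, forall z, z \in `[0, L] ->
       P1 p *m dPsi z + (P0 p + G0 p) *m Psi z
         - inB p z *m (Bc c)^T *m Gamma = 0})
    (cond_iii : {ae @lebesgue_measure R, forall z, z \in `[0, L] ->
       Bc c *m (inB p z)^T *m Psi z = 0}) :
  forall (Q : R -> 'M[R]_n) (Qc : 'M[R]_nc) (J : set R),
    plant_energy_matrix L Q -> symmetric_mx Qc -> time_interval J ->
    (forall (chi : R -> R -> 'cV[R]_n) (v : R -> 'cV[R]_nc),
       closed_loop_solution L p c Q Qc J chi v ->
       forall t, J t ->
       row_mx (e_bnd L p Q (chi t))^T (f_bnd L p Q (chi t))^T
         *m portR (P1 p) *m col_mx (Psi L) (Psi 0) = 0) ->
    invariant_along_solutions L p c Q Qc J (casimir L Gamma Psi).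
Proof.
move=> Q Qc J _ _ _ cond_iv chi v sol t Jt.
have bnd0 := cond_iv chi v sol t Jt.
have [[[P1T P1u] P0T [G0T _] B2] [AcT [ScT _]]] := (hp, hc).
have [[chi' Cchi plant_eq] [v' Cv ctrl_eq]] := sol.
have [_ Psi2 dPsi2 _] := hPsi.
have [[dw hw ae_chi'] _] := plant_eq t Jt.
have [_ chi't2 _ _] := Cchi t Jt.
set w := fun z => Q z *m chi t z in hw.
have [_ w2 dw2 _] := hw.
suff <- : casimir L Gamma Psi (chi' t) (v' t) = 0.
  exact: derivative_within_casimir.
rewrite casimirE (ctrl_eq t Jt).
(* Since (A_c - S_c)^T = -(A_c + S_c), this is condition (i) transposed; it removes the controller
   drift. *)
have GA : Gamma^T *m (Ac c - Sc c) = 0.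
  apply: trmx_inj; rewrite trmx_mul trmxK linearB /= AcT ScT.
  by rewrite -opprD mulNmx cond_i oppr0 trmx0.
rewrite mulmxDr !mulmxA GA !mul0mx add0r.
have iBw j : (@lebesgue_measure R).-integrable `[0, L]
    (EFin \o (fun z => plant_output p Q (chi t) z j 0)).
  under [X in EFin \o X]eq_fun do rewrite /plant_output -mulmxA.
  exact: integrable_trmx_mul.
have igBw := integrable_row_mul (Gamma^T *m Bc c) (measurable_itv _) iBw.
have iPchi' := integrable_bilinear_mx 1%:M Psi2 chi't2.
have idPw := integrable_bilinear_mx (P1 p) dPsi2 w2.
have iPdw := integrable_bilinear_mx (P1 p) Psi2 dw2.
rewrite -Rintegral_row_mul// addrC -RintegralD//.
have := is_H1_by_parts (P1 p) (ltW L_gt0) hPsi hw.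
(* Condition (iv) gives these terms with [w] on the left; transposing and using the symmetry of P_1
   puts [Psi] there. *)
have -> : ((Psi L)^T *m P1 p *m w L) 0 0 - ((Psi 0)^T *m P1 p *m w 0) 0 0 = 0.
  move: bnd0; rewrite portR_boundary_form// => /(congr1 (fun A => A^T 0 0)).
  by rewrite linearB /= !trmx_mul !trmxK P1T !mulmxA !mxE.
(* Integration by parts now says that the integral of (Psi')^T P_1 w + Psi^T P_1 w' vanishes; it
   remains to match integrands almost everywhere. *)
rewrite -RintegralD//; apply: etrans; congr fine; apply: ae_eq_integral => //.
- exact: measurable_int (integrableD _ iPchi' igBw).
- exact: measurable_int (integrableD _ idPw iPdw).
(* Conditions (ii), (iii) and the plant equation hold together off a null set, where the pointwise
   balance applies. *)
apply: (@filterS3 _ _ (ae_filter_ringOfSetsType _) _ _ _ _ _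
  cond_ii cond_iii ae_chi') => z cii ciii chi'E zL.
rewrite mulmx1 chi'E// /plant_output -(mulmxA _ (Q z)).
have addE (A B : 'M[R]_1) : (A + B) 0 0 = A 0 0 + B 0 0 by rewrite mxE.
have := casimir_balance (w z) (dw z) (Qc *m v t) P1T P0T G0T (cii zL) (ciii zL).
move=> /(congr1 (fun A : 'M[R]_1 => A 0 0)).
by rewrite !addE /controller_output -(mulmxA _ Qc) => ->.
Qed.
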